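(* Let $\epsilon>0$ and run the algorithm OSSBBA with tolerance $\epsilon$. Suppose that, when the algorithm reaches Step 1 of the $k$-th iteration, the currently selected simplex $\mathcal{S}^k$ satisfies $$d(\mathcal{S}^k)\le\frac{\epsilon}{\sum_{j=1}^{\bar p}\frac{\alpha_j}{d_{kj}}},\qquad\text{where } d_{kj}=\min_{t\in\mathcal{S}^k}t_j .$$ Then the algorithm terminates and outputs a global $\epsilon$-optimal solution of problem (EP). Besides, $\min_{t\in\mathcal{S}^k}\psi(t)-LB(\mathcal{S}^k)\le\epsilon$.
   Context: Setting. $p\ge 2$, $A\in\mathbb{R}^{m\times n}$, $b\in\mathbb{R}^m$, $\mathcal{X}=\{x\in\mathbb{R}^n : Ax\le b\}$ is nonempty, bounded and $n$-dimensional; $c_j\in\mathbb{R}^n$, $d_j\in\mathbb{R}$, $\alpha_j\in\mathbb{R}\setminus\{0\}$ and $\min_{x\in\mathcal{X}}(c_j^\top x+d_j)>0$ for $j=1,\dots,p$. The indices are ordered so that $\alpha_j>0$ for $j\in J^+=\{1,\dots,\bar p\}$ and $\alpha_j<0$ for $j\in J^-=\{\bar p+1,\dots,p\}$, where $1\le\bar p\le p$. For $j\in J^+$ let $\underline t_j=1/\max_{x\in\mathcal{X}}(c_j^\top x+d_j)>0$ and $\overline t_j=1/\min_{x\in\mathcal{X}}(c_j^\top x+d_j)$. Let $\mathcal{S}^0\subset\mathbb{R}^{\bar p}$ be the simplex with vertices $v^{0,1}=(\underline t_1,\dots,\underline t_{\bar p})^\top$ and $v^{0,j+1}=v^{0,1}+\bar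 p(\overline t_j-\underline t_j)e_j$, $j=1,\dots,\bar p$ ($e_j$ the standard basis vectors). Let $$\phi(x,t)=\sum_{j\in J^-}\alpha_j\ln(c_j^\top x+d_j)+\sum_{j\in J^+}\alpha_j\bigl(t_j(c_j^\top x+d_j)-\ln t_j-1\bigr),\qquad \psi(t)=\min_{x\in\mathcal{X}}\phi(x,t).$$ Problem (EP): minimize $\psi(t)$ over $t\in\mathcal{S}^0$. A point $t^*\in\mathcal{S}^0$ is a global $\epsilon$-optimal solution of (EP) if $\psi(t^* )\le\min_{t\in\mathcal{S}^0}\psi(t)+\epsilon$. For a simplex $\mathcal{S}=[v^1,\dots,v^{\bar p+1}]\subseteq\mathcal{S}^0$, $d(\mathcal{S})=\max_{i<j}\|v^i-v^j\|$ is the (Euclidean) length of its longest edge, and $$LB(\mathcal{S})=\min_{w\in\triangle_{\bar p}}\ \sum_{i=1}^{\bar p+1}\Bigl(\psi(v^i)+\sum_{j=1}^{\bar p}\alpha_j\ln v^i_j\Bigr)w_i-\sum_{j=1}^{\bar p}\alpha_j\ln\Bigl(\sum_{i=1}^{\bar p+1}v^i_jw_i\Bigr),$$ where $\triangle_{\bar p}=\{w\in\mathbb{R}^{\bar p+1}:\sum_i w_i=1,\ w_i\ge0\}$. Algorithm OSSBBA (tolerance $\epsilon>0$). Step 0: choose $t^*$ minimizing $\psi$ over the vertices of $\mathcal{S}^0$; set $UB^0=\psi(t^* )$, $LB^0=LB(\mathcal{S}^0)$, $\Xi=\{\mathcal{S}^0\}$ (list of active simplices), $k=0$. Step 1: if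 $UB^k-LB^k\le\epsilon$, terminate and output $t^*$. Step 2: choose a longest edge $\{v^{\tilde i},v^{\tilde j}\}$ of $\mathcal{S}^k$, let $\eta=\frac12(v^{\tilde i}+v^{\tilde j})$, and bisect $\mathcal{S}^k$ into $\mathcal{S}^{k1}$ (vertex $v^{\tilde j}$ replaced by $\eta$) and $\mathcal{S}^{k2}$ (vertex $v^{\tilde i}$ replaced by $\eta$). Step 3: if $\psi(\eta)<UB^k$, set $UB^k=\psi(\eta)$ and $t^*=\eta$. Step 4: compute $LB(\mathcal{S}^{k1})$ and $LB(\mathcal{S}^{k2})$; replace $\mathcal{S}^k$ in $\Xi$ by $\mathcal{S}^{k1},\mathcal{S}^{k2}$; for $s=1,2$, if $UB^k-LB(\mathcal{S}^{ks})\le\epsilon$, delete $\mathcal{S}^{ks}$ from $\Xi$. Step 5: if $\Xi=\emptyset$, stop and output $t^*$; otherwise set $LB^{k+1}=\min\{LB(\mathcal{S}):\mathcal{S}\in\Xi\}$ and $UB^{k+1}=UB^k$. Step 6: choose $\mathcal{S}^{k+1}\in\Xi$ with $LB(\mathcal{S}^{k+1})=LB^{k+1}$, increase $k$ by $1$, and return to Step 1. *)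

(* Defs.v *)
From mathcomp Require Import all_boot all_order all_algebra.
From mathcomp Require Import all_classical all_reals all_analysis.

Set Implicit Arguments.
Unset Strict Implicit.
Unset Printing Implicit Defensive.

Import Order.TTheory GRing.Theory Num.Theory.
Import numFieldNormedType.Exports.

Local Open Scope classical_set_scope.
Local Open Scope ring_scope.

(* Least and greatest elements of a set of reals; 0 when there is none.  In
   the statement every such set is the image of a nonempty compact set under a
   continuous function (or, for psi, a lower semicontinuous one). *)
Definition minimum (R : realType) (E : set R) : R :=
  xget 0 [set y | E y /\ lbound E y].

Definition maximum (R : realType) (E : set R) : R :=
  xget 0 [set y | E y /\ ubound E y].

(* The norm that the library puts on matrices is the sup norm. *)
Definition enorm (R : realType) (q : nat) (v : 'cV[R]_q) : R :=
  Num.sqrt (\sum_(j < q) v j 0 ^+ 2).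

(* [X] contains [n + 1] affinely independent points. *)
Definition full_dimensional (R : realType) (n : nat) (X : set 'cV[R]_n) :=
  exists z : 'I_n.+1 -> 'cV[R]_n, (forall i, X (z i)) /\
    \rank (\matrix_(i < n, j < n) (z (lift ord0 j) - z ord0) i 0) = n.

Definition prob_simplex (R : realType) (N : nat) : set 'cV[R]_N :=
  [set w | \sum_(i < N) w i 0 = 1 /\ forall i, 0 <= w i 0].

(* A simplex of R^q is given by its list of q + 1 vertices, which are not
   required to be affinely independent: the initial simplex below degenerates
   when one of the affine functions is constant on the feasible set. *)
Definition simplex (R : realType) (q : nat) := {ffun 'I_q.+1 -> 'cV[R]_q}.

Definition hull (R : realType) (q : nat) (S : simplex R q) : set 'cV[R]_q :=
  [set \sum_(i < q.+1) w i 0 *: S i | w in @prob_simplex R q.+1].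

Definition longest_edge_length (R : realType) (q : nat) (S : simplex R q) : R :=
  \big[Num.max/0]_(e : 'I_q.+1 * 'I_q.+1 | (e.1 < e.2)%N) enorm (S e.1 - S e.2).

Definition longest_edge (R : realType) (q : nat) (S : simplex R q)
    (i j : 'I_q.+1) : Prop :=
  i != j /\ enorm (S i - S j) = longest_edge_length S.

Definition midpoint (R : realType) (q : nat) (S : simplex R q)
    (i j : 'I_q.+1) : 'cV[R]_q :=
  2^-1 *: (S i + S j).

Definition replace_vertex (R : realType) (q : nat) (S : simplex R q)
    (i : 'I_q.+1) (v : 'cV[R]_q) : simplex R q :=
  [ffun l => if l == i then v else S l].

Definition bisection (R : realType) (q : nat) (S : simplex R q)
    (i j : 'I_q.+1) : seq (simplex R q) :=
  [:: replace_vertex S j (midpoint S i j); replace_vertex S i (midpoint S i j)].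

Record instance (R : realType) (m n p pbar : nat) := Instance {
  matA : 'M[R]_(m, n);
  rhs : 'cV[R]_m;
  cvec : 'I_p -> 'cV[R]_n;
  dcst : 'I_p -> R;
  alpha : 'I_p -> R;
  pbar_le_p : (pbar <= p)%N
}.

Section Problem.
Context {R : realType} {m n p pbar : nat} (P : instance R m n p pbar).

Definition feasible : set 'cV[R]_n :=
  [set x | forall i, (matA P *m x) i 0 <= rhs P i 0].

Definition affine_fun (j : 'I_p) (x : 'cV[R]_n) : R :=
  ((cvec P j)^T *m x) 0 0 + dcst P j.

Record standing_assumptions : Prop := {
  two_le_p : (2 <= p)%N;
  one_le_pbar : (1 <= pbar)%N;
  feasible_nonempty : feasible !=set0;
  feasible_bounded : bounded_set feasible;
  feasible_full_dimensional : full_dimensional feasible;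
  alpha_neq0 : forall j, alpha P j != 0;
  alpha_gt0 : forall j, (0 < alpha P j) = (j < pbar)%N;
  affine_fun_gt0 : forall j, 0 < minimum (affine_fun j @` feasible)
}.

(* With 0-based indices, J^+ is the set of j < pbar and J^- that of the j with
   pbar <= j < p. *)
Definition jpos (j : 'I_pbar) : 'I_p := widen_ord (pbar_le_p P) j.

Definition t_lower (j : 'I_pbar) : R :=
  1 / maximum (affine_fun (jpos j) @` feasible).

Definition t_upper (j : 'I_pbar) : R :=
  1 / minimum (affine_fun (jpos j) @` feasible).

Definition initial_simplex : simplex R pbar :=
  [ffun i => let v1 := \col_j t_lower j in
     if unlift ord0 i is Some j
     then v1 + (pbar%:R * (t_upper j - t_lower j)) *: delta_mx j 0
     else v1].

Definition phi (x : 'cV[R]_n) (t : 'cV[R]_pbar) : R :=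
  \sum_(j < p | (pbar <= j)%N) alpha P j * ln (affine_fun j x) +
  \sum_(j < pbar) alpha P (jpos j) *
    (t j 0 * affine_fun (jpos j) x - ln (t j 0) - 1).

Definition psi (t : 'cV[R]_pbar) : R :=
  minimum [set phi x t | x in feasible].

Definition eps_optimal (eps : R) (t : 'cV[R]_pbar) : Prop :=
  hull initial_simplex t /\
  psi t <= minimum (psi @` hull initial_simplex) + eps.

Definition LB_objective (S : simplex R pbar) (w : 'cV[R]_pbar.+1) : R :=
  \sum_(i < pbar.+1)
     (psi (S i) + \sum_(j < pbar) alpha P (jpos j) * ln (S i j 0)) * w i 0 -
  \sum_(j < pbar)
     alpha P (jpos j) * ln (\sum_(i < pbar.+1) S i j 0 * w i 0).

Definition LB (S : simplex R pbar) : R :=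
  minimum (LB_objective S @` @prob_simplex R pbar.+1).

(* The variables of the branch and bound algorithm OSSBBA at the beginning of
   an iteration, when the gap between the two bounds is tested. *)
Record state := State {
  upper_bound : R;
  lower_bound : R;
  incumbent : 'cV[R]_pbar;
  active : seq (simplex R pbar);
  current : simplex R pbar
}.

Variant config :=
  | AtGapTest of nat & state
  | Output of 'cV[R]_pbar.

(* [i] is the index of the chosen best vertex of the initial simplex. *)
Definition initial_state (i : 'I_pbar.+1) : state :=
  State (psi (initial_simplex i)) (LB initial_simplex) (initial_simplex i)
        [:: initial_simplex] initial_simplex.

Definition updated_UB (s : state) (eta : 'cV[R]_pbar) : R :=
  if psi eta < upper_bound s then psi eta else upper_bound s.

Definition updated_incumbent (s : state) (eta : 'cV[R]_pbar) : 'cV[R]_pbar :=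
  if psi eta < upper_bound s then eta else incumbent s.

(* The children are tested against the upper bound already updated with the
   midpoint; the other active simplices are kept without being tested again. *)
Definition updated_active (eps : R) (s : state) (i j : 'I_pbar.+1) :
    seq (simplex R pbar) :=
  let UB := updated_UB s (midpoint (current s) i j) in
  [seq T <- bisection (current s) i j | ~~ (UB - LB T <= eps)]
    ++ rem (current s) (active s).

(* One whole iteration, ending with an output or at the gap test of the next
   iteration.  It is a relation because the longest edge to bisect and the next
   simplex, an active one with the least lower bound, are chosen freely. *)
Inductive step (eps : R) : config -> config -> Prop :=
  | StopGap k s :
      upper_bound s - lower_bound s <= eps ->
      step eps (AtGapTest k s) (Output (incumbent s))
  | StopNoActive k s i j :
      ~~ (upper_bound s - lower_bound s <= eps) ->
      longest_edge (current s) i j ->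
      updated_active eps s i j = [::] ->
      step eps (AtGapTest k s)
        (Output (updated_incumbent s (midpoint (current s) i j)))
  | NextIteration k s i j S :
      ~~ (upper_bound s - lower_bound s <= eps) ->
      longest_edge (current s) i j ->
      S \in updated_active eps s i j ->
      (forall T, T \in updated_active eps s i j -> LB S <= LB T) ->
      step eps (AtGapTest k s)
        (AtGapTest k.+1
           (State (updated_UB s (midpoint (current s) i j)) (LB S)
                  (updated_incumbent s (midpoint (current s) i j))
                  (updated_active eps s i j) S)).

Inductive reachable (eps : R) : config -> Prop :=
  | ReachStart i :
      (forall l, psi (initial_simplex i) <= psi (initial_simplex l)) ->
      reachable eps (AtGapTest 0 (initial_state i))
  | ReachStep c c' :
      reachable eps c -> step eps c c' -> reachable eps c'.

End Problem.

(* Main.v *)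
Require Import Defs.
From mathcomp Require Import all_boot all_order all_algebra.
From mathcomp Require Import all_classical all_reals all_analysis.
From mathcomp Require Import lra.

Set Implicit Arguments.
Unset Strict Implicit.
Unset Printing Implicit Defensive.

Import Order.TTheory GRing.Theory Num.Theory.
Import numFieldNormedType.Exports.

Local Open Scope classical_set_scope.
Local Open Scope ring_scope.

(* Adding [sum_j alpha_j ln t_j] to [psi] gives a minimum of affine functions of
   [t], hence a concave function; [LB] interpolates it between the vertices, so
   it bounds [psi] from below on the simplex.  If [w] attains [LB S] and [t] is
   the corresponding point of [S], the [w]-average of the vertex values of [psi]
   exceeds [LB S] by [sum_j alpha_j sum_i w_i (ln t_j - ln v^i_j)], and
   [ln a - ln b <= (a - b) / b] bounds this by [d(S) sum_j alpha_j / d_j].  So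
   some vertex [v] of a small simplex has [psi v - LB S <= eps].  The upper
   bound never exceeds the value of [psi] at a vertex of an active simplex,
   hence the gap test succeeds.  The incumbent is then optimal because each
   point of the initial simplex lies in an active simplex or in one deleted
   because its lower bound was at least the upper bound minus [eps]. *)

(** * Attained extrema, continuity and compactness *)

(** The extreme value theorem makes the set from which [xget] chooses nonempty, so [minimum] is not
    the default 0 here. *)
Lemma minimum_attained (R : realType) (T : topologicalType) (A : set T)
    (f : T -> R) :
  A !=set0 -> compact A -> (forall x, A x -> {for x, continuous f}) ->
  (exists2 c, A c & f c = minimum (f @` A)) /\
  (forall x, A x -> minimum (f @` A) <= f x).
Proof.
move=> A0 cA cf.
have [|c /set_mem Ac minc] := compact_EVT_min (f := f) A0 cA.
  by apply: continuous_in_subspaceT => x /set_mem /cf.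
have [[d Ad fd] lb] : (f @` A) (minimum (f @` A)) /\
    lbound (f @` A) (minimum (f @` A)).
  apply: (@xgetPex _ 0 [set y | (f @` A) y /\ lbound (f @` A) y]).
  exists (f c); split; first by exists c.
  by move=> _ [x Ax <-]; apply: minc; apply: mem_set.
by split=> [|x Ax]; [exists d|apply: lb; exists x].
Qed.

Lemma maximum_attained (R : realType) (T : topologicalType) (A : set T)
    (f : T -> R) :
  A !=set0 -> compact A -> (forall x, A x -> {for x, continuous f}) ->
  exists2 c, A c & f c = maximum (f @` A).
Proof.
move=> A0 cA cf.
have [|c /set_mem Ac maxc] := compact_EVT_max (f := f) A0 cA.
  by apply: continuous_in_subspaceT => x /set_mem /cf.
have [[d Ad fd] _] : (f @` A) (maximum (f @` A)) /\
    ubound (f @` A) (maximum (f @` A)).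
  apply: (@xgetPex _ 0 [set y | (f @` A) y /\ ubound (f @` A) y]).
  exists (f c); split; first by exists c.
  by move=> _ [x Ax <-]; apply: maxc; apply: mem_set.
by exists d.
Qed.

Lemma continuous_sum (R : realType) (V : normedModType R) (T : topologicalType)
    (I : Type) (r : seq I) (Q : pred I) (F : I -> T -> V) (x : T) :
  (forall i, Q i -> {for x, continuous (F i)}) ->
  {for x, continuous (fun y => \sum_(i <- r | Q i) F i y)}.
Proof.
by move=> cF; apply: cvg_big => [|i Qi]; [exact: add_continuous|exact: cF].
Qed.

Lemma continuous_trmx (R : realType) (m n : nat) :
  continuous (@trmx R m n).
Proof.
move=> M s /nbhs_ballP [e e0 es].
apply/nbhs_ballP; exists e => //= N [_ MN]; apply: es; split=> // i j.
by rewrite !mxE; apply: MN.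
Qed.

(** Heine-Borel for columns: the set is closed inside the transpose of a compact box of row
    vectors. *)
Lemma bounded_closed_compact_cV (R : realType) (n : nat) (A : set 'cV[R]_n) :
  bounded_set A -> closed A -> compact A.
Proof.
move=> [M [Mreal bA]] clA.
(* Boundedness gives a norm bound for each radius strictly above [M], hence the choice [M + 1]. *)
have Aco : compact [set v : 'cV[R]_n |
    forall i, `[- (M + 1), M + 1]%classic (v i 0)].
  have := @rV_compact _ n (fun=> `[- (M + 1), M + 1]%classic : set R)
    (fun=> @segment_compact _ _ _).
  move/(continuous_compact (continuous_subspaceT (@continuous_trmx R 1 n))).
  congr compact; apply/seteqP; split=> [_ [v bv <-] i|v bv].
    by rewrite mxE; apply: bv.
  by exists v^T; rewrite ?trmxK// => i; rewrite mxE; apply: bv.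
apply: subclosed_compact clA Aco _ => v /bA bv i.
rewrite /= in_itv/= -ler_norml.
apply: le_trans (bv (M + 1) _); last by rewrite ltrDl.
rewrite [leRHS]/Num.norm /= mx_normrE; apply/bigmax_geP; right => /=.
by exists (i, 0).
Qed.

Lemma closed_forall (T : topologicalType) (I : Type) (F : I -> set T) :
  (forall i, closed (F i)) -> closed [set x | forall i, F i x].
Proof.
move=> cF; rewrite (_ : [set x | _] = \bigcap_i F i).
  by apply: closed_bigI.
by apply/seteqP; split=> x /= Fx i //; apply: Fx.
Qed.

Lemma prob_simplex_compact (R : realType) (N : nat) :
  compact (@prob_simplex R N).
Proof.
apply: bounded_closed_compact_cV.
  exists 1; split=> // M M1 w [w1 w0] /=.
  rewrite [leLHS]/Num.norm /= mx_normrE; apply/bigmax_leP.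
  split=> [|[i j] _ /=]; first by apply: ltW; rewrite (lt_trans ltr01).
  rewrite ord1 ger0_norm// (le_trans _ (ltW M1))// -w1 (bigD1 i)//= lerDl.
  by apply: sumr_ge0.
have -> : @prob_simplex R N = [set w : 'cV[R]_N | \sum_(i < N) w i 0 = 1] `&`
    [set w : 'cV[R]_N | forall i, 0 <= w i 0] by [].
apply: closedI.
  apply: (@closed_comp _ _ (fun w : 'cV[R]_N => \sum_(i < N) w i 0) [set 1]).
    by move=> w _; apply: continuous_sum => i _; exact: coord_continuous.
  exact: closed_eq.
apply: closed_forall => i.
apply: (@closed_comp _ _ (fun w : 'cV[R]_N => w i 0) [set x | 0 <= x]).
  by move=> w _; exact: coord_continuous.
exact: closed_ge.
Qed.

Lemma hull_compact (R : realType) (q : nat) (S : simplex R q) :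
  compact (hull S).
Proof.
apply: continuous_compact (@prob_simplex_compact R q.+1).
apply: continuous_subspaceT.
apply: (_ : continuous (fun w : 'cV[R]_q.+1 => \sum_(i < q.+1) w i 0 *: S i)).
move=> w; apply: continuous_sum => i _.
apply: (@cvgZr_tmp R 'cV[R]_q _ (nbhs w) _ (fun v : 'cV[R]_q.+1 => v i 0)).
exact: coord_continuous.
Qed.

Lemma continuous_mull (R : realType) (T : topologicalType) (a : R) (f : T -> R)
    (x : T) :
  {for x, continuous f} -> {for x, continuous (fun y => a * f y)}.
Proof. exact: cvgMl_tmp. Qed.

Lemma continuous_ln_comp (R : realType) (T : topologicalType) (f : T -> R)
    (x : T) :
  {for x, continuous f} -> 0 < f x -> {for x, continuous (fun y => ln (f y))}.
Proof. by move=> cf /continuous_ln cl; exact: continuous_comp. Qed.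

Lemma continuous_mulmx_cV (R : realType) (m n : nat) (A : 'M[R]_(m, n)) i :
  continuous (fun x : 'cV[R]_n => (A *m x) i 0).
Proof.
move=> x; under eq_fun do rewrite mxE.
apply: continuous_sum => l _; apply: continuous_mull.
exact: coord_continuous.
Qed.

Lemma continuous_pairl (T U : topologicalType) (u : U) :
  continuous (fun x : T => (x, u)).
Proof. by move=> x; apply: cvg_pair => //=; exact: cvg_cst. Qed.

(** * Convex hulls and bisection *)

Lemma hull_vertex (R : realType) (q : nat) (S : simplex R q) i : hull S (S i).
Proof.
exists (delta_mx i 0); last first.
  rewrite (bigD1 i)//= mxE !eqxx scale1r big1 ?addr0// => l /negbTE li.
  by rewrite mxE li scale0r.
split=> [|l]; last by rewrite mxE ler0n.
rewrite (bigD1 i)//= mxE !eqxx big1 ?addr0// => l /negbTE li.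
by rewrite mxE li.
Qed.

Lemma hull_midpoint (R : realType) (q : nat) (S T : simplex R q) i j :
  hull S (T i) -> hull S (T j) -> hull S (midpoint T i j).
Proof.
move=> [u [u1 u0] Ti] [v [v1 v0] Tj].
exists (2^-1 *: (u + v)); last first.
  rewrite /midpoint -Ti -Tj [RHS]scalerDr !scaler_sumr -big_split/=.
  by apply: eq_bigr => l _; rewrite !mxE mulrDr scalerDl !scalerA.
split=> [|l]; last by rewrite !mxE mulr_ge0// addr_ge0.
under eq_bigr do rewrite !mxE.
by rewrite -mulr_sumr big_split/= u1 v1 mulVf// pnatr_eq0.
Qed.

Lemma hull_coord (R : realType) (q : nat) (S : simplex R q)
    (w : 'cV[R]_q.+1) j :
  (\sum_(i < q.+1) w i 0 *: S i) j 0 = \sum_(i < q.+1) S i j 0 * w i 0.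
Proof. by rewrite summxE; apply: eq_bigr => i _; rewrite !mxE mulrC. Qed.

(** A zero sum of the nonnegative terms [a i * w i 0] would force every weight to vanish, although
    the weights sum to 1. *)
Lemma prob_simplex_avg_gt0 (R : realType) (N : nat) (a : 'I_N -> R)
    (w : 'cV[R]_N) :
  prob_simplex w -> (forall i, 0 < a i) -> 0 < \sum_(i < N) a i * w i 0.
Proof.
move=> [w1 w0] a0; rewrite lt_neqAle eq_sym sumr_ge0 ?andbT; last first.
  by move=> i _; rewrite mulr_ge0// ltW.
apply/negP; rewrite psumr_eq0 => [/allP z|i _]; last by rewrite mulr_ge0// ltW.
have : \sum_(i < N) w i 0 = 0.
  apply: big1 => i _; have := z i (mem_index_enum i).
  by rewrite implyTb mulf_eq0 gt_eqF//= => /eqP.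
by rewrite w1 => /eqP; rewrite oner_eq0.
Qed.

Lemma hull_gt0 (R : realType) (q : nat) (S : simplex R q) t :
  (forall i j, 0 < S i j 0) -> hull S t -> forall j, 0 < t j 0.
Proof.
move=> S0 [w hw <-] j; rewrite hull_coord.
by apply: prob_simplex_avg_gt0.
Qed.

(* Moving the smaller of the two weights w_i, w_j onto the midpoint. *)
Lemma hull_bisection_le (R : realType) (q : nat) (S : simplex R q) i j
    (w : 'cV[R]_q.+1) :
  i != j -> prob_simplex w -> w j 0 <= w i 0 ->
  hull (replace_vertex S j (midpoint S i j))
    (\sum_(l < q.+1) w l 0 *: S l).
Proof.
move=> ij [w1 w0] wji;
pose u : 'cV[R]_q.+1 := \col_l
  (if l == i then w i 0 - w j 0 else if l == j then w j 0 *+ 2 else w l 0).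
have sum2 (V : zmodType) (F : 'I_q.+1 -> V) :
    \sum_(l < q.+1) F l =
    F i + (F j + \sum_(l < q.+1 | (l != i) && (l != j)) F l).
  by rewrite (bigD1 i)//= (bigD1 j)//= eq_sym.
have ui : u i 0 = w i 0 - w j 0 by rewrite mxE eqxx.
have uj : u j 0 = w j 0 *+ 2 by rewrite mxE eq_sym (negbTE ij) eqxx.
have uO l : (l != i) && (l != j) -> u l 0 = w l 0.
  by case/andP => /negbTE li /negbTE lj; rewrite mxE li lj.
exists u.
  split=> [|l]; last first.
    rewrite mxE; case: ifP => _; rewrite ?subr_ge0//.
    by case: ifP => _; rewrite ?mulrn_wge0.
  rewrite -w1 !sum2 (eq_bigr _ uO) ui uj mulr2n !addrA.
  by congr (_ + _); rewrite subrK.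
rewrite !sum2 ui uj !ffunE eqxx (negbTE ij) /midpoint.
rewrite (eq_bigr (fun l => w l 0 *: S l)); last first.
  by move=> l lij; rewrite uO// ffunE; case/andP: lij => _ /negbTE ->.
rewrite !addrA; congr (_ + _).
rewrite scalerA -[w j 0 *+ 2]mulr_natr -mulrA divff ?pnatr_eq0// mulr1.
by rewrite scalerDr scalerBl addrA subrK.
Qed.

Lemma midpointC (R : realType) (q : nat) (S : simplex R q) i j :
  midpoint S i j = midpoint S j i.
Proof. by rewrite /midpoint addrC. Qed.

(** The larger of the weights at [i] and [j] tells which child contains the point; the two cases are
    symmetric. *)
Lemma hull_bisection (R : realType) (q : nat) (S : simplex R q) i j t :
  i != j -> hull S t -> exists2 T, T \in bisection S i j & hull T t.
Proof.
move=> ij [w hw <-]; have [wji|/ltW wij] := leP (w j 0) (w i 0).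
  exists (replace_vertex S j (midpoint S i j)); first by rewrite inE eqxx.
  exact: hull_bisection_le.
exists (replace_vertex S i (midpoint S i j)); first by rewrite !inE eqxx orbT.
by rewrite midpointC; apply: hull_bisection_le; rewrite 1?eq_sym.
Qed.

Lemma bisection_vertex (R : realType) (q : nat) (S T : simplex R q) i j l :
  T \in bisection S i j -> T l = midpoint S i j \/ exists l', T l = S l'.
Proof.
rewrite !inE => /orP[] /eqP ->; rewrite ffunE; case: ifP => _.
all: by [left|right; exists l].
Qed.

(** * Edge lengths and a logarithmic inequality *)

Lemma le_enorm (R : realType) (q : nat) (v : 'cV[R]_q) j : v j 0 <= enorm v.
Proof.
apply: (le_trans (ler_norm _)); rewrite -sqrtr_sqr ler_wsqrtr// (bigD1 j)//=.
by rewrite lerDl sumr_ge0// => l _; exact: sqr_ge0.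
Qed.

Lemma enormN (R : realType) (q : nat) (v : 'cV[R]_q) : enorm (- v) = enorm v.
Proof.
by rewrite /enorm; congr Num.sqrt; apply: eq_bigr => j _; rewrite mxE sqrrN.
Qed.

Lemma longest_edge_length_ge0 (R : realType) (q : nat) (S : simplex R q) :
  0 <= longest_edge_length S.
Proof. exact: bigmax_ge_id. Qed.

Lemma le_longest_edge_length (R : realType) (q : nat) (S : simplex R q) i l j :
  S i j 0 - S l j 0 <= longest_edge_length S.
Proof.
(* The maximum runs over pairs with [e.1 < e.2] only: the reversed pair needs [enormN], and the
   diagonal falls under the initial value 0. *)
have [il|li|/val_inj ->] := ltngtP i l.
- have /le_trans := le_enorm (S i - S l) j; rewrite !mxE; apply.
  exact: (@le_bigmax_cond _ _ _ 0 (i, l)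
    (fun e : 'I_q.+1 * 'I_q.+1 => (e.1 < e.2)%N)
    (fun e => enorm (S e.1 - S e.2))).
- have /le_trans := le_enorm (S i - S l) j; rewrite !mxE; apply.
  rewrite -enormN opprB.
  exact: (@le_bigmax_cond _ _ _ 0 (l, i)
    (fun e : 'I_q.+1 * 'I_q.+1 => (e.1 < e.2)%N)
    (fun e => enorm (S e.1 - S e.2))).
- by rewrite subrr longest_edge_length_ge0.
Qed.

(** The difference is the [w]-average of the differences [S i j 0 - S l j 0]. *)
Lemma hull_sub_vertex_le (R : realType) (q : nat) (S : simplex R q) t l j :
  hull S t -> t j 0 - S l j 0 <= longest_edge_length S.
Proof.
move=> [w [w1 w0] <-]; rewrite hull_coord -[S l j 0]mulr1 -w1 mulr_sumr -sumrB.
rewrite -[leRHS]mulr1 -w1 mulr_sumr; apply: ler_sum => i _.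
by rewrite -mulrBl ler_wpM2r// le_longest_edge_length.
Qed.

(** This is [ln (1 + x) <= x] at [x = a / b - 1]. *)
Lemma ln_sub_le (R : realType) (a b : R) :
  0 < a -> 0 < b -> ln a - ln b <= (a - b) / b.
Proof.
move=> a0 b0; rewrite -ln_div ?posrE// -[a / b](subrK 1) addrC.
rewrite mulrBl divff ?gt_eqF//.
by apply: le_ln1Dx; rewrite ltrBrDl subrr divr_gt0.
Qed.

(** * Positivity and attainment for problem (EP) *)

Section Problem.
Context {R : realType} {m n p pbar : nat} (P : instance R m n p pbar).
Hypothesis hP : standing_assumptions P.

Lemma feasible_compact : compact (feasible P).
Proof.
apply: bounded_closed_compact_cV; first exact: feasible_bounded hP.
apply: closed_forall => i.
apply: (@closed_comp _ _ (fun x : 'cV[R]_n => (matA P *m x) i 0)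
  [set y | y <= rhs P i 0]); last exact: closed_le.
by move=> x _; exact: continuous_mulmx_cV.
Qed.

Lemma affine_fun_continuous j : continuous (affine_fun P j).
Proof.
move=> x; apply: continuousD; last exact: cst_continuous.
exact: continuous_mulmx_cV.
Qed.

Lemma affine_fun_pos j x : feasible P x -> 0 < affine_fun P j x.
Proof.
move=> Fx; apply: lt_le_trans (affine_fun_gt0 hP j) _.
have [_] := minimum_attained (feasible_nonempty hP) feasible_compact
  (fun x _ => @affine_fun_continuous j x).
exact.
Qed.

Lemma t_lower_gt0_le j : 0 < t_lower P j /\ t_lower P j <= t_upper P j.
Proof.
have [y Fy maxE] := maximum_attained (feasible_nonempty hP) feasible_compact
  (fun x _ => @affine_fun_continuous (jpos P j) x).
have [_ /(_ y Fy)] := minimum_attained (feasible_nonempty hP) feasible_compact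
  (fun x _ => @affine_fun_continuous (jpos P j) x).
rewrite {}maxE => le_mm; have min0 := affine_fun_gt0 hP (jpos P j).
have max0 := lt_le_trans min0 le_mm.
by rewrite /t_lower /t_upper !div1r invr_gt0 lef_pV2.
Qed.

(** Later simplices have their vertices in the initial hull, so this keeps every [ln (t j 0)] at a
    positive argument. *)
Lemma initial_simplex_gt0 i j : 0 < initial_simplex P i j 0.
Proof.
have low0 := (t_lower_gt0_le j).1.
rewrite ffunE; case: unliftP => [l _|_]; rewrite !mxE//.
by rewrite ltr_wpDr// !mulr_ge0// subr_ge0 (t_lower_gt0_le l).2.
Qed.

Definition pos_orthant : set 'cV[R]_pbar := [set t | forall j, 0 < t j 0].

(** Continuity is joint in [x] and [t] because [psi] is later minimized through [phi] on pairs. *)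
Lemma phi_continuous z : feasible P z.1 -> pos_orthant z.2 ->
  {for z, continuous (fun z => phi P z.1 z.2)}.
Proof.
case: z => x t /= Fx t0.
have cf j : {for (x, t), continuous (fun z => affine_fun P j z.1)}.
  apply: (@continuous_comp _ _ _ fst (affine_fun P j)); first exact: cvg_fst.
  exact: affine_fun_continuous.
have ct j : {for (x, t),
    continuous (fun z : 'cV[R]_n * 'cV[R]_pbar => z.2 j 0)}.
  apply: (@continuous_comp _ _ _ snd (fun t : 'cV[R]_pbar => t j 0)).
    exact: cvg_snd.
  exact: coord_continuous.
apply: continuousD; apply: continuous_sum => j _; apply: continuous_mull.
  by apply: continuous_ln_comp; [exact: cf|exact: affine_fun_pos].
apply: continuousB; last exact: cst_continuous.
apply: continuousB; first by apply: continuousM; [exact: ct|exact: cf].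
by apply: continuous_ln_comp; [exact: ct|exact: t0].
Qed.

Lemma psi_attained t : pos_orthant t ->
  (exists2 x, feasible P x & phi P x t = psi P t) /\
  (forall x, feasible P x -> psi P t <= phi P x t).
Proof.
move=> t0; apply: minimum_attained (feasible_nonempty hP) feasible_compact _.
move=> x Fx.
apply: (@continuous_comp _ _ _ (fun x => (x, t)) (fun z => phi P z.1 z.2)).
  exact: continuous_pairl.
exact: phi_continuous.
Qed.

(* [psi] is minimized through the continuous function [phi] on the compact set
   [feasible * K], which avoids proving that [psi] is continuous. *)
Lemma psi_minimum_attained (K : set 'cV[R]_pbar) :
  K !=set0 -> compact K -> K `<=` pos_orthant ->
  (exists2 t, K t & psi P t = minimum (psi P @` K)) /\
  (forall t, K t -> minimum (psi P @` K) <= psi P t).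
Proof.
move=> [t1 Kt1] cK K0; have [x1 Fx1] := feasible_nonempty hP.
have [] := @minimum_attained R _ (feasible P `*` K) (fun z => phi P z.1 z.2).
- by exists (x1, t1).
- by apply: compact_setX => //; exact: feasible_compact.
- by move=> z [Fz /K0 Kz]; exact: phi_continuous.
move=> [[x0 t0] [/= Fx0 Kt0] <-] min0.
have lb t : K t -> psi P t0 <= psi P t.
  move=> Kt; have [[x Fx <-] _] := psi_attained (K0 _ Kt).
  have [_ /(_ _ Fx0) /le_trans] := psi_attained (K0 _ Kt0); apply.
  exact: (min0 (x, t)).
have [[t Kt <-] lb'] : (psi P @` K) (minimum (psi P @` K)) /\
    lbound (psi P @` K) (minimum (psi P @` K)).
  apply: (@xgetPex _ 0 [set y | (psi P @` K) y /\ lbound (psi P @` K) y]).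
  exists (psi P t0); split; first by exists t0.
  by move=> _ [t Kt <-]; exact: lb.
by split=> [|u Ku]; [exists t|apply: lb'; exists u].
Qed.

(** * The lower bound on a single simplex *)

Section Simplex.
Variable S : simplex R pbar.
Hypothesis S_gt0 : forall i, pos_orthant (S i).

Lemma LB_attained :
  (exists2 w, prob_simplex w & LB_objective P S w = LB P S) /\
  (forall w, prob_simplex w -> LB P S <= LB_objective P S w).
Proof.
apply: minimum_attained; last 2 first.
- exact: prob_simplex_compact.
- move=> w hw; apply: continuousB; apply: continuous_sum => i _;
    apply: continuous_mull.
    exact: coord_continuous.
  apply: continuous_ln_comp.
    apply: continuous_sum => l _; apply: continuous_mull.
    exact: coord_continuous.
  by apply: prob_simplex_avg_gt0 => // l; exact: S_gt0.
by have [w hw _] := hull_vertex S ord0; exists w.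
Qed.

(* [phi x t + sum_j alpha_j ln t_j] is affine in [t], and [LB_objective]
   interpolates its minimum over [x] between the vertices. *)
Lemma LB_le_psi t : hull S t -> LB P S <= psi P t.
Proof.
move=> St; have t0 := hull_gt0 S_gt0 St.
(* [x] is optimal for [t]; at the vertices it is merely feasible, which bounds [psi] there from
   above, as needed. *)
have [[x Fx <-] _] := psi_attained t0.
case: St t0 => w hw <- t0; have [w1 w0] := hw.
have [_ /(_ w hw) /le_trans] := LB_attained; apply.
pose h j (s : R) := alpha P (jpos P j) * (s * affine_fun P (jpos P j) x - 1).
have [g phiE] : exists g, forall s,
    phi P x s + \sum_(j < pbar) alpha P (jpos P j) * ln (s j 0) =
      g + \sum_(j < pbar) h j (s j 0).
  exists (\sum_(j < p | (pbar <= j)%N) alpha P j * ln (affine_fun P j x)) => s.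
  rewrite /phi -addrA -big_split/=; congr (_ + _).
  by apply: eq_bigr => j _; rewrite -mulrDr addrAC subrK.
rewrite /LB_objective lerBlDr.
under [X in _ + X]eq_bigr do rewrite -hull_coord.
rewrite phiE; apply: (@le_trans _ _
  (\sum_(i < pbar.+1) (g + \sum_(j < pbar) h j (S i j 0)) * w i 0)).
  apply: ler_sum => i _; rewrite ler_wpM2r// -phiE lerD2r.
  by have [_] := psi_attained (@S_gt0 i); apply.
under eq_bigr do rewrite mulrDl mulr_suml.
rewrite big_split/= -mulr_sumr w1 mulr1 lerD2l exchange_big/=.
(* Writing the constant 1 in [h] as the sum of the weights makes the affine interpolation exact. *)
apply: ler_sum => j _; rewrite hull_coord /h -[X in _ - X]w1.
rewrite mulr_suml -sumrB mulr_sumr; apply: ler_sum => i _.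
by rewrite -mulrA mulrBl mul1r mulrAC.
Qed.

(** A vertex is produced, rather than any point of the hull, because [upper_bound] is compared with
    [psi] at vertices. *)
Lemma vertex_gap eps :
  longest_edge_length S <=
    eps / \sum_(j < pbar) (alpha P (jpos P j) /
             minimum [set t j 0 | t in hull S]) ->
  exists i, psi P (S i) - LB P S <= eps.
Proof.
set d := fun j => minimum [set t j 0 | t in hull S] => hsmall.
have dP j : 0 < d j /\ forall i, d j <= S i j 0.
  have [|[t St tE] lb] := @minimum_attained R _ (hull S) (fun t => t j 0) _
    (@hull_compact _ _ S) (fun t _ => @coord_continuous _ _ _ j 0 t).
    by exists (S ord0); exact: hull_vertex.
  split; first by rewrite /d -tE; exact: (hull_gt0 S_gt0 St).
  by move=> i; apply: lb; exact: hull_vertex.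
have a0 j : 0 < alpha P (jpos P j) by rewrite (alpha_gt0 hP) /=.
(* The sum is nonempty since [1 <= pbar]; its positivity allows clearing the denominator in
   [hsmall]. *)
have sum0 : 0 < \sum_(j < pbar) (alpha P (jpos P j) / d j).
  have j0 : 'I_pbar := Ordinal (one_le_pbar hP).
  rewrite (bigD1 j0)//= ltr_wpDr ?divr_gt0 ?(dP j0).1//.
  by rewrite sumr_ge0// => j _; rewrite divr_ge0// ltW// (dP j).1.
move: hsmall; rewrite ler_pdivlMr// => hsmall.
have [w hw LBE] := LB_attained.1; have [w1 w0] := hw.
(* The minimum of [psi] over the vertices is at most its [w]-average. *)
have [i _ imin] := arg_minP (fun i => psi P (S i))
  (isT : predT (ord0 : 'I_pbar.+1)).
exists i; apply: le_trans hsmall.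
pose t := \sum_(i < pbar.+1) w i 0 *: S i.
have St : hull S t by exists w.
have t0 := hull_gt0 S_gt0 St.
have lnt i' : \sum_(j < pbar) alpha P (jpos P j) * ln (t j 0) -
    \sum_(j < pbar) alpha P (jpos P j) * ln (S i' j 0) <=
    longest_edge_length S * \sum_(j < pbar) (alpha P (jpos P j) / d j).
  rewrite -sumrB mulr_sumr; apply: ler_sum => j _.
  rewrite -mulrBr mulrCA ler_wpM2l ?(ltW (a0 j))//.
  apply: le_trans (ln_sub_le (t0 j) (S_gt0 i' j)) _.
  have [dj0 djle] := dP j.
  (* First the numerator is enlarged to the longest edge, then the denominator is shrunk to
     [d j]. *)
  rewrite (@le_trans _ _ (longest_edge_length S / S i' j 0))//.
    by rewrite ler_wpM2r ?hull_sub_vertex_le// invr_ge0 ltW//; exact: S_gt0.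
  rewrite ler_wpM2l ?longest_edge_length_ge0// lef_pV2 ?posrE//; exact: S_gt0.
rewrite lerBlDr -lerBlDl -LBE /LB_objective.
under [X in _ <= _ - X]eq_bigr do rewrite -hull_coord -/t.
(* The left side does not depend on the vertex; multiplied by the sum of the weights, it is compared
   term by term. *)
rewrite lerBrDl -[leLHS]mulr1 -w1 mulr_sumr; apply: ler_sum => l _.
rewrite ler_wpM2r// addrA lerBlDr.
have := lnt l; have := imin l isT; lra.
Qed.

End Simplex.
End Problem.

(** * The invariant of the branch and bound loop *)

Section Invariant.
Context {R : realType} {m n p pbar : nat} (P : instance R m n p pbar).
Variable eps : R.

(** [active_vertex] makes the gap test succeed on a small simplex. [active_cover] accounts for
    deletions: its first alternative persists because the upper bound never increases. *)
Record invariant (s : @state R pbar) : Prop := {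
  incumbent_hull : hull (initial_simplex P) (incumbent s);
  psi_incumbent : psi P (incumbent s) = upper_bound s;
  current_active : current s \in active s;
  lower_boundE : lower_bound s = LB P (current s);
  current_min : forall T, T \in active s -> LB P (current s) <= LB P T;
  active_vertex : forall T, T \in active s -> forall i,
    hull (initial_simplex P) (T i) /\ upper_bound s <= psi P (T i);
  active_cover : forall t, hull (initial_simplex P) t ->
    upper_bound s - eps <= psi P t \/ exists2 T, T \in active s & hull T t
}.

Lemma initial_invariant i :
  (forall l, psi P (initial_simplex P i) <= psi P (initial_simplex P l)) ->
  invariant (initial_state P i).
Proof.
move=> imin; split=> //=; first exact: hull_vertex.
- by rewrite inE.
- by move=> T; rewrite inE => /eqP ->.
- by move=> T; rewrite inE => /eqP -> l; split; first exact: hull_vertex.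
- by move=> t ht; right; exists (initial_simplex P); rewrite ?inE.
Qed.

Lemma updated_UB_le (s : @state R pbar) eta :
  updated_UB P s eta <= upper_bound s /\ updated_UB P s eta <= psi P eta.
Proof. by rewrite /updated_UB; case: ltP => // /ltW. Qed.

Hypothesis hP : standing_assumptions P.

(** The midpoint is the only new vertex, and the updated upper bound is at most [psi] there;
    bisection preserves the cover up to deleted children. *)
Lemma next_invariant (s : @state R pbar) i j S :
  invariant s -> longest_edge (current s) i j ->
  S \in updated_active P eps s i j ->
  (forall T, T \in updated_active P eps s i j -> LB P S <= LB P T) ->
  invariant (State (updated_UB P s (midpoint (current s) i j)) (LB P S)
    (updated_incumbent P s (midpoint (current s) i j))
    (updated_active P eps s i j) S).
Proof.
move=> Is [ij _] SA Smin; set eta := midpoint _ _ _.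
have [leUB leeta] := updated_UB_le s eta.
have eta_hull : hull (initial_simplex P) eta.
  by apply: hull_midpoint; apply: (active_vertex Is (current_active Is) _).1.
have bisV T : T \in bisection (current s) i j -> forall l,
    hull (initial_simplex P) (T l) /\ updated_UB P s eta <= psi P (T l).
  move=> Tb l; have [->|[l' ->]] := bisection_vertex l Tb; first by split.
  have [hl UBl] := active_vertex Is (current_active Is) l'.
  by split=> //; exact: le_trans UBl.
split=> //=.
- by rewrite /updated_incumbent; case: ifP => // _; exact: incumbent_hull Is.
- rewrite /updated_incumbent /updated_UB -/eta.
  by case: ifP => // _; exact: psi_incumbent Is.
- move=> T; rewrite mem_cat => /orP[|/mem_rem TA l].
    by rewrite mem_filter => /andP[_]; exact: bisV.
  have [hl UBl] := active_vertex Is TA l.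
  by split=> //; exact: le_trans UBl.
- move=> t ht; have [UBt|[T TA Tt]] := active_cover Is ht.
    by left; apply: le_trans UBt; rewrite lerD2r.
  (* [rem] affects the current simplex only, so any other active simplex survives. *)
  have [TE|TN] := eqVneq T (current s); last first.
    right; exists T => //; rewrite mem_cat; apply/orP; right.
    exact: rem_mem.
  rewrite TE in Tt; have [U Ub Ut] := hull_bisection ij Tt.
  (* If the child [U] is deleted, [LB_le_psi] turns the deletion test into the first alternative of
     the cover. *)
  have [UBU|UBU] := boolP (updated_UB P s eta - LB P U <= eps); last first.
    by right; exists U => //; rewrite mem_cat mem_filter UBU Ub.
  have U0 l : pos_orthant (U l).
    by apply: hull_gt0 (initial_simplex_gt0 hP) _; exact: (bisV U Ub l).1.
  by left; apply: le_trans (LB_le_psi hP U0 Ut); rewrite lerBlDl -lerBlDr.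
Qed.

(** Induction on runs; an output carries no state, so nothing is claimed there. *)
Lemma reachable_invariant c :
  reachable P eps c -> if c is AtGapTest _ s then invariant s else True.
Proof.
elim=> [i|{}c c' _ IH cc']; first exact: initial_invariant.
case: cc' IH => // k s i j S _ edge SA Smin Is.
exact: next_invariant.
Qed.

End Invariant.

Theorem theorem4p1 (R : realType) (m n p pbar : nat)
    (P : instance R m n p pbar) (hP : standing_assumptions P)
    (eps : R) (eps_gt0 : 0 < eps)
    (k : nat) (s : @state R pbar)
    (hreach : reachable P eps (AtGapTest k s))
    (hsmall : longest_edge_length (current s) <=
       eps / \sum_(j < pbar) (alpha P (jpos P j) /
                minimum [set t j 0 | t in hull (current s)])) :
  [/\ forall c : config, step P eps (AtGapTest k s) c <-> c = Output (incumbent s),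
      eps_optimal P eps (incumbent s)
    & minimum (psi P @` hull (current s)) - LB P (current s) <= eps].
Proof.
have Is : invariant P eps s := reachable_invariant hP hreach.
have init0 := initial_simplex_gt0 hP.
have cur0 i : pos_orthant (current s i).
  by apply: hull_gt0 init0 _; exact: (active_vertex Is (current_active Is) i).1.
have [i gap] := vertex_gap hP cur0 hsmall.
have UBLB : upper_bound s - lower_bound s <= eps.
  rewrite (lower_boundE Is) (le_trans _ gap)// lerD2r.
  exact: (active_vertex Is (current_active Is) i).2.
split.
- move=> c; split=> [|->]; last exact: StopGap.
  (* By inversion: the other two rules require the gap test to fail, against [UBLB]. *)
  move E: (AtGapTest k s) => c0 st.
  by case: st E => [k' s' _ [_ <-]|k' s' i' j' + _ _ [_ sE]
    |k' s' i' j' S' + _ _ _ [_ sE]] //; rewrite -sE UBLB.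
- split; first exact: incumbent_hull Is.
  have [[t ht <-] _] := psi_minimum_attained hP
    (ex_intro _ _ (hull_vertex (initial_simplex P) ord0))
    (@hull_compact _ _ (initial_simplex P)) (fun t => @hull_gt0 _ _ _ t init0).
  rewrite (psi_incumbent Is) -lerBlDr.
  (* If the minimizer [t] still lies in an active [T], then [lower_bound s <= LB P T <= psi P t],
     and the gap test concludes. *)
  have [//|[T TA Tt]] := active_cover Is ht.
  have T0 l : pos_orthant (T l).
    by apply: hull_gt0 init0 _; exact: (active_vertex Is TA l).1.
  apply: le_trans (LB_le_psi hP T0 Tt); apply: le_trans (current_min Is TA).
  by rewrite -(lower_boundE Is) lerBlDl -lerBlDr.
- have [_ le_min] := psi_minimum_attained hP
    (ex_intro _ _ (hull_vertex (current s) ord0))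
    (@hull_compact _ _ (current s)) (fun t => @hull_gt0 _ _ _ t cur0).
  by apply: le_trans gap; rewrite lerD2r; apply: le_min; exact: hull_vertex.
Qed.
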